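(* The following statements are equivalent: $$\exists x\in\mathbb{C}^{(2N+1)2n},\ x\ne0:\ (\lambda I-\mathcal{L}_\xi^N)x=0\quad\Longleftrightarrow\quad\exists v\in\mathbb{C}^{2n},\ v\neq0:\ H_N(\lambda,\xi)v=0,$$ where $$H_N(\lambda,\xi):=\lambda I-M_0-\sum_{i=1}^m\left(M_ip_N(-\tau_i;\lambda)+M_{-i}p_N(\tau_i;\lambda)\right)-\left(N_1p_N(-\tau_0;\lambda)+N_{-1}p_N(\tau_0;\lambda)\right).$$
   Context: Let $\lambda\in\mathbb{C}$, $A_0,\dots,A_m\in\mathbb{R}^{n\times n}$, $B\in\mathbb{R}^{n\times n_u}$, $C\in\mathbb{R}^{n_y\times n}$, $D\in\mathbb{R}^{n_y\times n_u}$, and $\tau_0,\dots,\tau_m\ge0$ with $\max_{0\le i\le m}\tau_i=1$. Let $\xi>0$ be such that $D_\xi=D^TD-\xi^2I$ is nonsingular, and put $$M_0=\begin{bmatrix}A_0&-BD_\xi^{-1}B^T\\-C^TC+C^TDD_\xi^{-1}D^TC&-A_0^T\end{bmatrix},\ M_i=\begin{bmatrix}A_i&0\\0&0\end{bmatrix},\ M_{-i}=\begin{bmatrix}0&0\\0&-A_i^T\end{bmatrix}\ (1\le i\le m),$$ $$N_1=\begin{bmatrix}0&0\\0&C^TDD_\xi^{-1}B^T\end{bmatrix},\ N_{-1}=\begin{bmatrix}-BD_\xi^{-1}D^TC&0\\0&0\end{bmatrix}.$$ Grid: $N$ is a positive integer and $-1\le\theta_{N,-N}<\dots<\theta_{N,-1}<\theta_{N,0}=0<\theta_{N,1}<\dots<\theta_{N,N}\le1$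 with $\theta_{N,-i}=-\theta_{N,i}$. Matrix $\mathcal{L}_\xi^N$: for a block vector $x=(x_{-N},\dots,x_N)$ with $x_i\in\mathbb{C}^{2n}$, let $\mathcal{P}_Nx$ be the unique $\mathbb{C}^{2n}$-valued polynomial of degree $\le2N$ with $\mathcal{P}_Nx(\theta_{N,i})=x_i$ for $i=-N,\dots,N$. Then $\mathcal{L}_\xi^N$ is the linear map (matrix) on $\mathbb{C}^{(2N+1)2n}$ with $(\mathcal{L}_\xi^Nx)_i=(\mathcal{P}_Nx)'(\theta_{N,i})$ for $i\ne0$ and $$(\mathcal{L}_\xi^Nx)_0=M_0\mathcal{P}_Nx(0)+\sum_{i=1}^m(M_i\mathcal{P}_Nx(-\tau_i)+M_{-i}\mathcal{P}_Nx(\tau_i))+N_1\mathcal{P}_Nx(-\tau_0)+N_{-1}\mathcal{P}_Nx(\tau_0).$$ Polynomial $p_N$: for $\lambda\in\mathbb{C}$, $p_N(\cdot;\lambda)$ is the scalar polynomial of degree at most $2N$ satisfying $p_N(0;\lambda)=1$ and $p_N'(\theta_{N,i};\lambda)=\lambda p_N(\theta_{N,i};\lambda)$ for $i\in\{-N,\dots,-1,1,\dots,N\}$ (derivative in the first argument).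
   Formalization: The equivalence is stated for those λ for which the polynomial p_N(·;λ) exists (it is then unique); for exceptional λ, e.g. N=1, grid −1,0,1 and λ²=2, no such polynomial exists and H_N(λ,ξ) is undefined. *)

(* Defs.v *)
From HB Require Import structures.
From mathcomp Require Import all_boot all_order all_algebra.
From mathcomp Require Import reals.
From mathcomp Require Export complex.

Set Implicit Arguments.
Unset Strict Implicit.
Unset Printing Implicit Defensive.

Import Order.TTheory GRing.Theory Num.Theory.
Local Open Scope ring_scope.
Local Open Scope complex_scope.

Section Interpolation.
Variables (F : fieldType) (K : nat).
Implicit Types (t : 'I_K -> F).

Definition lagrange_basis t (j : 'I_K) : {poly F} :=
  \prod_(i < K | i != j) ((t j - t i)^-1 *: ('X - (t i)%:P)).

(* A vector-valued polynomial is a column of scalar polynomials. *)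
Definition interpolant d t (x : 'I_K -> 'cV[F]_d) : 'cV[{poly F}]_d :=
  \col_k \sum_(j < K) x j k 0 *: lagrange_basis t j.

Definition evalv d (q : 'cV[{poly F}]_d) (z : F) : 'cV[F]_d :=
  map_mx (fun f : {poly F} => f.[z]) q.

Definition derivv d (q : 'cV[{poly F}]_d) : 'cV[{poly F}]_d :=
  map_mx (fun f : {poly F} => f^`()) q.

Lemma lagrange_basis_eval t i j :
  injective t -> (lagrange_basis t j).[t i] = (i == j)%:R.
Proof.
move=> tI; rewrite horner_prod; have [->|nij] := eqVneq i j.
  rewrite big1 // => k nkj; rewrite hornerZ hornerXsubC mulVf //.
  by rewrite subr_eq0 (inj_eq tI) eq_sym.
by rewrite (bigD1 i) //= hornerZ hornerXsubC subrr mulr0 mul0r.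
Qed.

Lemma size_lagrange_basis t j : (size (lagrange_basis t j) <= K)%N.
Proof.
apply: leq_trans (size_poly_prod_leq _ _) _.
have -> : #|(fun i => i != j)| = K.-1 by rewrite -[K in RHS]card_ord -(cardC1 j).
rewrite leq_subLR.
apply: (@leq_trans (\sum_(i < K | i != j) 2).+1).
  rewrite ltnS; apply: leq_sum => i _.
  by apply: leq_trans (size_scale_leq _ _) _; rewrite size_XsubC.
rewrite (eq_bigl (fun i => i \in predC1 j)) // sum_nat_const cardC1 card_ord.
by case: K j => [[]//|k] _ /=; rewrite muln2 -addnn addnS.
Qed.

Lemma interpolantP d t (x : 'I_K -> 'cV[F]_d) (q : 'cV[{poly F}]_d) :
  injective t ->
  ((forall k, (size (q k ord0) <= K)%N) /\ (forall i, evalv q (t i) = x i))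
    <-> q = interpolant t x.
Proof.
move=> tI.
have size_int k : (size (interpolant t x k ord0) <= K)%N.
  rewrite mxE; apply: leq_trans (size_sum _ _ _) _; apply/bigmax_leqP => j _.
  exact: leq_trans (size_scale_leq _ _) (size_lagrange_basis _ _).
have eval_int k i : (interpolant t x k ord0).[t i] = x i k 0.
  rewrite mxE horner_sum (bigD1 i) //= hornerZ lagrange_basis_eval // eqxx mulr1.
  rewrite big1 ?addr0 // => j nji.
  by rewrite hornerZ lagrange_basis_eval // eq_sym (negPf nji) mulr0.
split=> [[sq eq]|->]; last first.
  by split=> // i; apply/colP => k; rewrite mxE eval_int.
apply/colP => k; apply/eqP; rewrite -subr_eq0; apply/eqP.
pose s := [seq t i | i <- enum 'I_K].
apply: (@roots_geq_poly_eq0 _ _ s).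
- apply/allP => _ /mapP[i _ ->]; rewrite /root hornerD hornerN eval_int.
  by have /colP/(_ k) := eq i; rewrite mxE => ->; rewrite subrr.
- by rewrite map_inj_uniq ?enum_uniq.
- rewrite size_map size_enum_ord; apply: leq_trans (size_polyD _ _) _.
  by rewrite geq_max size_polyN sq size_int.
Qed.

End Interpolation.

Section Hamiltonian.
Variables (R : realType) (n nu ny m : nat).
Variables (A : 'I_m.+1 -> 'M[R]_n) (B : 'M[R]_(n, nu)).
Variables (C : 'M[R]_(ny, n)) (D : 'M[R]_(ny, nu)) (xi : R).

Definition toC p q (X : 'M[R]_(p, q)) : 'M[R[i]]_(p, q) :=
  map_mx (fun r : R => r%:C) X.

Definition Dxi : 'M[R]_nu := D^T *m D - (xi ^+ 2)%:M.

Definition M0 : 'M[R[i]]_(n + n) :=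
  toC (block_mx (A ord0)
                (- (B *m invmx Dxi *m B^T))
                (- (C^T *m C) + C^T *m D *m invmx Dxi *m D^T *m C)
                (- (A ord0)^T)).

(* M_i and M_{-i}, meant for 1 <= i <= m. *)
Definition Mpos (i : 'I_m.+1) : 'M[R[i]]_(n + n) := toC (block_mx (A i) 0 0 0).
Definition Mneg (i : 'I_m.+1) : 'M[R[i]]_(n + n) :=
  toC (block_mx 0 0 0 (- (A i)^T)).

Definition Npos : 'M[R[i]]_(n + n) :=
  toC (block_mx 0 0 0 (C^T *m D *m invmx Dxi *m B^T)).
Definition Nneg : 'M[R[i]]_(n + n) :=
  toC (block_mx (- (B *m invmx Dxi *m D^T *m C)) 0 0 0).

Variable tau : 'I_m.+1 -> R.

Section Discretization.
Variables (N : nat) (theta : 'I_(N.*2.+1) -> R).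

(* Grid points and blocks are indexed by 'I_(2N+1) instead of -N, ..., N:
   index k stands for k - N, so rev_ord is negation and [mid] is index 0. *)
Definition mid : 'I_(N.*2.+1) := inord N.

Definition grid (i : 'I_(N.*2.+1)) : R[i] := (theta i)%:C.

Definition block_dim : nat := (\sum_(i < N.*2.+1) (n + n))%N.

Definition block (x : 'cV[R[i]]_block_dim) (i : 'I_(N.*2.+1)) :
    'cV[R[i]]_(n + n) :=
  @submxcol _ _ (fun _ : 'I_(N.*2.+1) => (n + n)%N) _ x i.

(* By interpolantP, the unique interpolant of degree <= 2N of the blocks of x. *)
Definition PN (x : 'cV[R[i]]_block_dim) : 'cV[{poly R[i]}]_(n + n) :=
  interpolant grid (block x).

Definition LN_row0 (x : 'cV[R[i]]_block_dim) : 'cV[R[i]]_(n + n) :=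
  M0 *m evalv (PN x) 0
  + \sum_(k < m.+1 | k != ord0)
      (Mpos k *m evalv (PN x) (- tau k)%:C + Mneg k *m evalv (PN x) (tau k)%:C)
  + (Npos *m evalv (PN x) (- tau ord0)%:C + Nneg *m evalv (PN x) (tau ord0)%:C).

Definition LN_fun (x : 'cV[R[i]]_block_dim) : 'cV[R[i]]_block_dim :=
  \mxcol_(i < N.*2.+1)
    (if i == mid then LN_row0 x else evalv (derivv (PN x)) (grid i)).

Definition LN : 'M[R[i]]_block_dim :=
  \matrix_(a, b) LN_fun (delta_mx b 0) a 0.

Lemma evalv_PN x z :
  evalv (PN x) z = \sum_j (lagrange_basis grid j).[z] *: block x j.
Proof.
apply/colP => k; rewrite !mxE horner_sum summxE; apply: eq_bigr => j _.
by rewrite hornerZ !mxE mulrC.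
Qed.

Lemma evalv_derivv_PN x z :
  evalv (derivv (PN x)) z =
  \sum_j (lagrange_basis grid j)^`().[z] *: block x j.
Proof.
apply/colP => k; rewrite !mxE raddf_sum horner_sum summxE.
by apply: eq_bigr => j _; rewrite /= derivZ hornerZ !mxE mulrC.
Qed.

Lemma LN_fun_linear : linear LN_fun.
Proof.
have bl a x y j : block (a *: x + y) j = a *: block x j + block y j.
  by apply/colP => k; rewrite !mxE.
have e0 a x y z : evalv (PN (a *: x + y)) z = a *: evalv (PN x) z + evalv (PN y) z.
  rewrite !evalv_PN scaler_sumr -big_split /=; apply: eq_bigr => j _.
  by rewrite bl scalerDr !scalerA mulrC.
have e1 a x y z : evalv (derivv (PN (a *: x + y))) z =
    a *: evalv (derivv (PN x)) z + evalv (derivv (PN y)) z.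
  rewrite !evalv_derivv_PN scaler_sumr -big_split /=; apply: eq_bigr => j _.
  by rewrite bl scalerDr !scalerA mulrC.
have e2 (M : 'M_(n + n)) a x y z : M *m evalv (PN (a *: x + y)) z =
    a *: (M *m evalv (PN x) z) + M *m evalv (PN y) z.
  by rewrite e0 mulmxDr scalemxAr.
have e3 (M M' : 'M_(n + n)) a x y z z' :
    M *m evalv (PN (a *: x + y)) z + M' *m evalv (PN (a *: x + y)) z' =
    a *: (M *m evalv (PN x) z + M' *m evalv (PN x) z')
    + (M *m evalv (PN y) z + M' *m evalv (PN y) z').
  by rewrite e2 e2 scalerDr addrACA.
have regroup (V : lmodType R[i]) a (X Y S T P Q : V) :
    (a *: X + Y) + (a *: S + T) + (a *: P + Q)
    = a *: (X + S + P) + (Y + T + Q).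
  by rewrite [a *: X + Y + _]addrACA [LHS]addrACA !scalerDr.
have e4 a x y : LN_row0 (a *: x + y) = a *: LN_row0 x + LN_row0 y.
  rewrite -regroup /LN_row0 e2 e3; congr (_ + _ + _).
  rewrite scaler_sumr -big_split /=.
  by apply: eq_bigr => k _; rewrite e3.
move=> a x y; apply/colP => r.
rewrite [LHS]mxE [RHS]mxE [X in _ = X + _]mxE.
rewrite [LN_fun x r 0]mxE [LN_fun y r 0]mxE.
by case: ifP => _; rewrite (e1, e4) [LHS]mxE [X in X + _ = _]mxE.
Qed.

Lemma LN_mulmx x : LN *m x = LN_fun x.
Proof.
pose L := GRing.isLinear.Build _ _ _ _ LN_fun LN_fun_linear.
pose f : {linear _ -> _} := HB.pack LN_fun L.
rewrite -[LN_fun x]/(f x) [in RHS](matrix_sum_delta x) linear_sum.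
apply/colP => a; rewrite !mxE summxE; apply: eq_bigr => b _.
by rewrite big_ord1 linearZ /= !mxE mulrC.
Qed.

(* p is the polynomial p_N( . ; lambda).  It need not exist for every lambda: for
   N = 1 and theta = (-1, 0, 1) it does not when lambda ^+ 2 = 2. *)
Definition is_pN (lambda : R[i]) (p : {poly R[i]}) : Prop :=
  [/\ (size p <= N.*2.+1)%N, p.[0] = 1 &
      forall i, i != mid -> p^`().[grid i] = lambda * p.[grid i]].

End Discretization.

Definition HN (p : {poly R[i]}) (lambda : R[i]) : 'M[R[i]]_(n + n) :=
  lambda%:M - M0
  - \sum_(k < m.+1 | k != ord0)
      (p.[(- tau k)%:C] *: Mpos k + p.[(tau k)%:C] *: Mneg k)
  - (p.[(- tau ord0)%:C] *: Npos + p.[(tau ord0)%:C] *: Nneg).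

End Hamiltonian.

(* Main.v *)
Require Import Defs.
From mathcomp Require Import all_boot all_order all_algebra.
From mathcomp Require Import reals.

Set Implicit Arguments.
Unset Strict Implicit.

Import Order.TTheory GRing.Theory Num.Theory.
Local Open Scope ring_scope.

(** The collocation equations for [p_N] have at most one solution as soon as they
    have one.  If [p] is a solution and [q] solves the same equations with
    [q(0) = 0], then [r = p_d q - q_d p], with [d = 2N] and [p_d], [q_d] the
    coefficients of degree [d], has degree below [d] while [r' - lambda r] vanishes
    at [d] points, so [r' = lambda r].  For nonzero [lambda] this forces [r = 0],
    and [r(0) = - q_d] gives [q_d = 0]; the same argument then applies to [q]
    itself.  For [lambda = 0] it applies to [q] directly, [q'] having degree
    below [d].  Consequently an eigenvector [x] of the discretization has
    [P_N x = p_N v] with [v = x_0], and its central block equation is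
    [H_N v = 0]; conversely every such [v] yields an eigenvector. *)

Section Collocation.
Variables (F : numDomainType) (lambda : F).
Implicit Types (p q r : {poly F}) (s : seq F).

(** Differentiation strictly lowers the degree of a nonzero polynomial, which rules out nonzero
    [lambda]. For [lambda = 0], characteristic zero makes [r] constant, and its root [c] makes it
    zero. *)
Lemma deriv_eigen_eq0 r c : r^`() = lambda *: r -> r.[c] = 0 -> r = 0.
Proof.
move=> dr rc; apply/eqP/negP => /negP r0.
have := lt_size_deriv r0; rewrite dr.
have [l0 _|l0] := eqVneq lambda 0; last by rewrite size_scale // ltnn.
case/negP: r0; rewrite [r]size1_polyC in rc *.
  by move: rc; rewrite hornerC => ->.
apply/leq_sizeP => -[//|j] _.
have := congr1 (fun u : {poly F} => u`_j) dr.
by rewrite l0 scale0r coef_deriv coef0 => /eqP; rewrite mulrn_eq0 => /eqP.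
Qed.

(** The residual [r' - lambda r] has at least as many distinct roots as its size, so it vanishes. *)
Lemma deriv_eigen_nodes s r : uniq s ->
  (size (r^`() - lambda *: r)%R <= size s)%N ->
  {in s, forall a, r^`().[a] = lambda * r.[a]} -> r^`() = lambda *: r.
Proof.
move=> us sz rs; apply/eqP; rewrite -subr_eq0; apply/eqP.
apply: (@roots_geq_poly_eq0 _ _ s) => //; apply/allP => a /rs ra.
by rewrite /root hornerD hornerN hornerZ ra subrr.
Qed.

Lemma size_deriv_eigen d r : (size r <= d)%N ->
  (size (r^`() - lambda *: r)%R <= d)%N.
Proof.
move=> sr; apply: leq_trans (size_polyD _ _) _.
rewrite geq_max size_polyN (leq_trans (size_scale_leq _ _) sr) andbT.
have [->|r0] := eqVneq r 0; first by rewrite deriv0 size_poly0.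
exact: leq_trans (ltnW (lt_size_deriv r0)) sr.
Qed.

Lemma collocation_unique s c p q : uniq s ->
  (size p <= (size s).+1)%N -> (size q <= (size s).+1)%N ->
  p.[c] = 1 -> q.[c] = 0 ->
  {in s, forall a, p^`().[a] = lambda * p.[a]} ->
  {in s, forall a, q^`().[a] = lambda * q.[a]} -> q = 0.
Proof.
move=> us sp sq pc qc hp hq; set d := size s in sp sq.
(* A priori the residual of [q] may have degree [d], one too many for [d] nodes to force it to
   vanish. *)
suff szq : (size (q^`() - lambda *: q)%R <= d)%N.
  by apply: deriv_eigen_eq0 qc; apply: deriv_eigen_nodes szq hq.
have [l0|l0] := eqVneq lambda 0.
  rewrite l0 scale0r subr0; have [->|q0] := eqVneq q 0.
    by rewrite deriv0 size_poly0.
  by rewrite -ltnS (leq_trans (lt_size_deriv q0)).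
apply: size_deriv_eigen.
pose r := p`_d *: q - q`_d *: p.
have sr : (size r <= d)%N.
  apply/leq_sizeP => j; rewrite coefB !coefZ leq_eqVlt => /predU1P[<-|dj].
    by rewrite mulrC subrr.
  by rewrite (leq_sizeP _ _ sq j) // (leq_sizeP _ _ sp j) // !mulr0 subrr.
have dr : r^`() = lambda *: r.
  apply: (deriv_eigen_nodes us (size_deriv_eigen sr)) => a sa.
  rewrite derivB !derivZ !(hornerD, hornerN, hornerZ) hp // hq //.
  by rewrite mulrBr !(mulrCA lambda).
have r0 : r = 0.
  apply/eqP/negP => /negP r0; have := lt_size_deriv r0.
  by rewrite dr size_scale // ltnn.
have qd : q`_d = 0.
  have := congr1 (fun u : {poly F} => u.[c]) r0.
  rewrite hornerD hornerN !hornerZ qc pc mulr0 sub0r mulr1 horner0.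
  by move/eqP; rewrite oppr_eq0 => /eqP.
apply/leq_sizeP => j; rewrite leq_eqVlt => /predU1P[<- //|dj].
exact: (leq_sizeP _ _ sq).
Qed.

End Collocation.

Section Discretization.
Variables (R : realType) (n nu ny m : nat).
Variables (A : 'I_m.+1 -> 'M[R]_n) (B : 'M[R]_(n, nu)).
Variables (C : 'M[R]_(ny, n)) (D : 'M[R]_(ny, nu)) (xi : R).
Variables (tau : 'I_m.+1 -> R) (N : nat) (theta : 'I_(N.*2.+1) -> R).
Hypothesis theta_inj : injective theta.
Hypothesis theta_mid : theta (mid N) = 0.
Variables (lambda : R[i]) (p : {poly R[i]}).
Hypothesis p_def : is_pN theta lambda p.
Implicit Types (x : 'cV[R[i]]_(block_dim n N)) (v : 'cV[R[i]]_(n + n)).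

Lemma grid_inj : injective (grid theta).
Proof. by move=> i j [/theta_inj]. Qed.

Lemma grid_mid : grid theta (mid N) = 0.
Proof. by rewrite /grid theta_mid. Qed.

(** Every delayed value of [p v] is a scalar times [v], and [p(0) = 1] accounts for the [M0] term.
    The central eigenvalue equation thus becomes [HN v = 0]. *)
Lemma LN_row0_separable x v :
  (forall z, evalv (PN theta x) z = p.[z] *: v) ->
  LN_row0 A B C D xi tau theta x = lambda *: v - HN A B C D xi tau p lambda *m v.
Proof.
have [_ p0 _] := p_def.
move=> e; rewrite /HN -!addrA -!opprD addrA mulmxBl mul_scalar_mx subKr.
rewrite !mulmxDl mulmx_suml.
rewrite /LN_row0 !e p0 scale1r -!scalemxAl -!scalemxAr; congr (_ + _ + (_ + _)).
by apply: eq_bigr => k _; rewrite !e mulmxDl -!scalemxAl -!scalemxAr.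
Qed.

(** Since [p] has degree at most [2N], [p v] is the interpolant of its own nodal values. *)
Lemma PN_separable x v :
  (forall i, block x i = p.[grid theta i] *: v) ->
  PN theta x = \col_k (v k 0 *: p).
Proof.
have [sp _ _] := p_def; move=> e; apply/esym/(interpolantP _ _ grid_inj).
split=> [k|i]; first by rewrite mxE (leq_trans (size_scale_leq _ _)).
by rewrite e; apply/colP => k; rewrite !mxE hornerZ mulrC.
Qed.

Lemma evalv_separable v z :
  evalv (\col_k (v k 0 *: p)) z = p.[z] *: v.
Proof. by apply/colP => k; rewrite !mxE hornerZ mulrC. Qed.

Lemma derivv_separable v z :
  evalv (derivv (\col_k (v k 0 *: p))) z = p^`().[z] *: v.
Proof. by apply/colP => k; rewrite !mxE derivZ hornerZ mulrC. Qed.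

Lemma LN_eigenP x :
  (lambda%:M - LN A B C D xi tau theta) *m x = 0 <->
  LN_row0 A B C D xi tau theta x = lambda *: block x (mid N) /\
  forall i, i != mid N ->
    evalv (derivv (PN theta x)) (grid theta i) = lambda *: block x i.
Proof.
rewrite mulmxBl mul_scalar_mx LN_mulmx; split=> [/eqP|[h0 hi]].
  rewrite subr_eq0 => /eqP e.
  have b i : block (LN_fun A B C D xi tau theta x) i = lambda *: block x i.
    by rewrite -e; apply/colP => k; rewrite !mxE.
  split=> [|i /negPf ni]; rewrite -b /block mxcolK ?eqxx //.
  by rewrite ni.
apply/eqP; rewrite subr_eq0; apply/eqP/mxcolP => i; rewrite mxcolK.
have -> : submxcol (lambda *: x) i = lambda *: block x i.
  by apply/colP => k; rewrite !mxE.
by case: eqVneq => [->|/hi].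
Qed.

(** Each component of [PN x - p v] solves the collocation equations and vanishes at 0, so
    uniqueness, with [p] as the normalized solution, makes it zero. *)
Lemma PN_eigen x :
  (forall i, i != mid N ->
    evalv (derivv (PN theta x)) (grid theta i) = lambda *: block x i) ->
  PN theta x = \col_k (block x (mid N) k 0 *: p).
Proof.
have [sp p0 hp] := p_def; move=> hx; set v := block x (mid N).
have [sx ex] := (interpolantP (block x) (PN theta x) grid_inj).2 erefl.
have ek i k : (PN theta x k 0).[grid theta i] = block x i k 0.
  by rewrite -ex [RHS]mxE.
(* The [2N] noncentral nodes: one fewer than the number of coefficients allowed. *)
pose s := [seq grid theta i | i in predC1 (mid N)].
have ss : size s = N.*2 by rewrite size_image cardC1 card_ord.
have hs (P : R[i] -> Prop) :
    (forall i, i != mid N -> P (grid theta i)) -> {in s, forall a, P a}.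
  by move=> hP a /imageP[i ni ->]; exact: hP.
apply/colP => k; rewrite [RHS]mxE; apply/eqP; rewrite -subr_eq0; apply/eqP.
apply: (@collocation_unique _ lambda s 0 p) => //.
- by rewrite map_inj_uniq ?enum_uniq //; exact: grid_inj.
- by rewrite ss.
- rewrite ss; apply: leq_trans (size_polyD _ _) _.
  by rewrite geq_max size_polyN sx (leq_trans (size_scale_leq _ _)).
- have := ek (mid N) k; rewrite grid_mid => e0.
  by rewrite hornerD hornerN hornerZ p0 mulr1 e0 subrr.
- exact: hs.
- apply: hs => i ni; rewrite derivB derivZ !(hornerD, hornerN, hornerZ) hp //.
  rewrite ek mulrBr (mulrCA lambda); congr (_ - _).
  by have /colP/(_ k) := hx i ni; rewrite !mxE.
Qed.

Lemma LN_eigenvector_HN x : x != 0 ->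
  (lambda%:M - LN A B C D xi tau theta) *m x = 0 ->
  block x (mid N) != 0 /\ HN A B C D xi tau p lambda *m block x (mid N) = 0.
Proof.
move=> x0 /LN_eigenP[h0 /PN_eigen eP]; split.
  (* A zero central block would give [PN x = 0], hence zero values at all nodes. *)
  apply: contra_neq x0 => v0; apply/mxcolP => i.
  have [_ ex] := (interpolantP (block x) (PN theta x) grid_inj).2 erefl.
  rewrite -[submxcol x i]/(block x i) -ex eP evalv_separable v0 scaler0.
  by apply/colP => k; rewrite !mxE.
have e z : evalv (PN theta x) z = p.[z] *: block x (mid N).
  by rewrite eP evalv_separable.
move: h0; rewrite (LN_row0_separable e) => /eqP.
by rewrite subr_eq addrC -subr_eq subrr eq_sym => /eqP.
Qed.

Lemma HN_kernel_LN v : v != 0 -> HN A B C D xi tau p lambda *m v = 0 ->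
  exists x, x != 0 /\ (lambda%:M - LN A B C D xi tau theta) *m x = 0.
Proof.
have [_ p0 hp] := p_def; move=> v0 hv.
(* The eigenvector samples [p v] on the grid; its central block is [v], so it is nonzero. *)
pose x : 'cV[R[i]]_(block_dim n N) := \mxcol_i (p.[grid theta i] *: v).
have bx i : block x i = p.[grid theta i] *: v by rewrite /block mxcolK.
have bx0 : block x (mid N) = v by rewrite bx grid_mid p0 scale1r.
have eP := PN_separable bx.
exists x; split.
  apply: contra_neq v0 => x0; rewrite -bx0 x0.
  by apply/colP => k; rewrite !mxE.
apply/LN_eigenP; split=> [|i ni].
  rewrite (@LN_row0_separable _ v) ?hv ?subr0 ?bx0 // => z.
  by rewrite eP evalv_separable.
by rewrite eP derivv_separable hp // bx scalerA.
Qed.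

End Discretization.

Theorem proposition3p2 (R : realType) (n nu ny m : nat)
    (A : 'I_m.+1 -> 'M[R]_n) (B : 'M[R]_(n, nu))
    (C : 'M[R]_(ny, n)) (D : 'M[R]_(ny, nu))
    (tau : 'I_m.+1 -> R) (xi : R)
    (N : nat) (theta : 'I_(N.*2.+1) -> R)
    (lambda : R[i]) (p : {poly R[i]})
    (tau_ge0 : forall k, 0 <= tau k)
    (tau_max : \big[Num.max/0]_(k < m.+1) tau k = 1)
    (xi_gt0 : 0 < xi)
    (Dxi_unit : Dxi D xi \in unitmx)
    (N_gt0 : (0 < N)%N)
    (theta_bnd : forall i, -1 <= theta i <= 1)
    (theta_incr : forall i j : 'I_(N.*2.+1), (i < j)%N -> theta i < theta j)
    (theta_mid : theta (mid N) = 0)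
    (theta_sym : forall i, theta (rev_ord i) = - theta i)
    (p_def : is_pN theta lambda p) :
  (exists x : 'cV[R[i]]_(block_dim n N),
     x != 0 /\ (lambda%:M - LN A B C D xi tau theta) *m x = 0)
  <->
  (exists v : 'cV[R[i]]_(n + n),
     v != 0 /\ HN A B C D xi tau p lambda *m v = 0).
Proof.
have theta_inj : injective theta.
  move=> i j e; apply: val_inj.
  by case: (ltngtP i j) => // /theta_incr; rewrite e ltxx.
split=> [[x [x0 hx]]|[v [v0 hv]]].
  by exists (block x (mid N)); exact: (LN_eigenvector_HN theta_inj).
exact: HN_kernel_LN v0 hv.
Qed.
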